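(* (1) Let $F\colon\mathscr{C}\rightleftarrows\mathscr{D}\colon U$ be an oplax monoidal adjunction with counit $\varepsilon$. The strong monoidal structure of $U$ turns $\mathscr{C}$ into a left $\mathscr{D}$-module category by $d\triangleright c:=Ud\otimes c$. With respect to this structure, the bimonad $T:=UF$ on $\mathscr{C}$ becomes an oplax $\mathscr{D}$-module monad with coherence morphism, for $c\in\mathscr{C}$, $d\in\mathscr{D}$, $$T_{\mathsf a;d,c}\colon T(d\triangleright c)=T(Ud\otimes c)\xrightarrow{T_{2;Ud,c}}TUd\otimes Tc\xrightarrow{U\varepsilon_d\otimes Tc}Ud\otimes Tc=d\triangleright Tc.$$ In particular, for $x\in\mathscr{C}$, the morphism $T_{\mathsf a;Fx,c}$ is precisely the right fusion operator of $T$ at $(x,c)$: $T_{\mathsf a;Fx,c}=T_{\mathsf{rf};x,c}$. (2) Let $T$ be a bimonad on a monoidal category $\mathscr{C}$, and regard $T$ as an oplax $\mathscr{C}^T$-module monad on $\mathscr{C}$ by applying (1) to the Eilenberg–Moore adjunction $\mathscr{C}\rightleftarrows\mathscr{C}^T$. The right fusion operators of $T$ are invertible if and only if the coherence morphisms of this oplax $\mathscr{C}^T$-module structure on $T$ are invertible. In other words, $T$ is right Hopf if and only if it is a strong $\mathscr{C}^T$-module monad.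
   Context: All categories and functors are $\Bbbk$-linear over a field $\Bbbk$; associators and unitors are suppressed. An oplax monoidal adjunction is an adjunction $F\dashv U$ between monoidal categories with $F,U$ oplax monoidal (structure maps $F_2\colon F(x\otimes y)\to Fx\otimes Fy$, $F_0\colon F1\to1$, etc.) and unit, counit oplax monoidal transformations; then $U$ is automatically strong monoidal. A bimonad on $\mathscr{C}$ is a monad $(T,\mu,\eta)$ with oplax monoidal structure $T_2,T_0$ such that $\mu,\eta$ are oplax monoidal; $UF$ is a bimonad with $T_{2;x,y}=U_{2;Fx,Fy}\circ UF_{2;x,y}$, $T_0=U_0\circ UF_0$. For a bimonad $T$, $\mathscr{C}^T$ is monoidal with strict monoidal forgetful functor, and the Eilenberg–Moore adjunction is oplax monoidal. The right fusion operator of a bimonad $T$ is $T_{\mathsf{rf};x,y}\colon T(Tx\otimes y)\xrightarrow{T_{2;Tx,y}}T^2x\otimes Ty\xrightarrow{\mu_x\otimes Ty}Tx\otimes Ty$; $T$ is right Hopf if it is invertible for all $x,y$. An oplax $\mathscr{D}$-module monad on a left $\mathscr{D}$-module category is a monad $T$ with natural coherent maps $T_{\mathsf a;d,c}\colon T(d\triangleright c)\to d\triangleright Tc$ (oplax $\mathscr{D}$-module structure) such that $\mu,\eta$ are $\mathscr{D}$-module transformations; it is strong if all $T_{\mathsf a;d,c}$ are invertible. *)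

(* Defs.v *)
From HB Require Import structures.
From mathcomp Require Import all_boot ssralg.

Set Implicit Arguments.
Unset Strict Implicit.
Unset Printing Implicit Defensive.
#[local] Obligation Tactic := simpl.

Import GRing.Theory.
Local Open Scope ring_scope.

Declare Scope cat_scope.
Delimit Scope cat_scope with cat.
Reserved Notation "g ∘ f" (at level 40, left associativity).
Reserved Notation "x ⊗ y" (at level 35, right associativity).
Reserved Notation "f ⊠ g" (at level 35, right associativity).

Record category (k : fieldType) := Category {
  obj :> Type;
  hom : obj -> obj -> lmodType k;
  idm : forall x, hom x x;
  compm : forall x y z, hom y z -> hom x y -> hom x z;
  comp1m : forall x y (f : hom x y), compm (idm y) f = f;
  compm1 : forall x y (f : hom x y), compm f (idm x) = f;
  compmA : forall w x y z (h : hom y z) (g : hom x y) (f : hom w x),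
    compm h (compm g f) = compm (compm h g) f;
  comp_linear_r : forall x y z (g : hom y z), linear (@compm x y z g);
  comp_linear_l : forall x y z (f : hom x y), linear (fun g : hom y z => compm g f)
}.

Notation "g ∘ f" := (compm g f) : cat_scope.
Local Open Scope cat_scope.

Definition invertible (k : fieldType) (C : category k) (x y : C) (f : hom x y) : Prop :=
  exists g : hom y x, g ∘ f = idm x /\ f ∘ g = idm y.

Record functor (k : fieldType) (C D : category k) := Functor {
  fobj :> C -> D;
  fmap : forall x y, hom x y -> hom (fobj x) (fobj y);
  fmap1 : forall x, fmap (idm x) = idm (fobj x);
  fmapM : forall x y z (g : hom y z) (f : hom x y), fmap (g ∘ f) = fmap g ∘ fmap f;
  fmap_linear : forall x y, linear (@fmap x y)
}.

Definition natural (k : fieldType) (C D : category k) (F G : functor C D)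
    (theta : forall x, hom (F x) (G x)) : Prop :=
  forall x y (f : hom x y), fmap G f ∘ theta x = theta y ∘ fmap F f.

Definition functor_id (k : fieldType) (C : category k) : functor C C :=
  @Functor k C C (fun x => x) (fun x y f => f)
    (fun=> erefl) (fun _ _ _ _ _ => erefl) (fun _ _ _ _ _ => erefl).

Program Definition functor_comp (k : fieldType) (C D E : category k)
    (G : functor D E) (F : functor C D) : functor C E :=
  @Functor k C E (fun x => G (F x)) (fun x y f => fmap G (fmap F f)) _ _ _.
Next Obligation. by move=> *; rewrite !fmap1. Qed.
Next Obligation. by move=> *; rewrite !fmapM. Qed.
Next Obligation. by move=> *; move=> ? ? ?; rewrite !fmap_linear. Qed.

(* Associators and unitors are explicit; they need not be identities. *)
Record monoidal (k : fieldType) := Monoidal {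
  mcat :> category k;
  tens : mcat -> mcat -> mcat;
  tensm : forall x x' y y' : mcat,
    hom x x' -> hom y y' -> hom (tens x y) (tens x' y');
  tens1 : forall x y : mcat, tensm (idm x) (idm y) = idm (tens x y);
  tensM : forall (x x' x'' y y' y'' : mcat)
      (f' : hom x' x'') (f : hom x x') (g' : hom y' y'') (g : hom y y'),
    tensm (f' ∘ f) (g' ∘ g) = tensm f' g' ∘ tensm f g;
  tens_linear_r : forall (x x' y y' : mcat) (f : hom x x'),
    linear (@tensm x x' y y' f);
  tens_linear_l : forall (x x' y y' : mcat) (g : hom y y'),
    linear (fun f : hom x x' => tensm f g);
  munit : mcat;
  massoc : forall x y z, hom (tens (tens x y) z) (tens x (tens y z));
  mlunit : forall x, hom (tens munit x) x;
  mrunit : forall x, hom (tens x munit) x;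
  massoc_inv : forall x y z, invertible (massoc x y z);
  mlunit_inv : forall x, invertible (mlunit x);
  mrunit_inv : forall x, invertible (mrunit x);
  massoc_nat : forall (x x' y y' z z' : mcat)
      (f : hom x x') (g : hom y y') (h : hom z z'),
    massoc x' y' z' ∘ tensm (tensm f g) h = tensm f (tensm g h) ∘ massoc x y z;
  mlunit_nat : forall (x y : mcat) (f : hom x y),
    mlunit y ∘ tensm (idm munit) f = f ∘ mlunit x;
  mrunit_nat : forall (x y : mcat) (f : hom x y),
    mrunit y ∘ tensm f (idm munit) = f ∘ mrunit x;
  mpentagon : forall w x y z,
    tensm (idm w) (massoc x y z) ∘ massoc w (tens x y) z ∘ tensm (massoc w x y) (idm z)
    = massoc w x (tens y z) ∘ massoc (tens w x) y z;
  mtriangle : forall x y,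
    tensm (idm x) (mlunit y) ∘ massoc x munit y = tensm (mrunit x) (idm y)
}.

Notation "x ⊗ y" := (tens x y) : cat_scope.
Notation "f ⊠ g" := (tensm f g) : cat_scope.
Arguments munit {k} m.

Section TensorLemmas.
Variables (k : fieldType) (C : monoidal k).

Lemma tensMl (x y z w : C) (g : hom y z) (f : hom x y) :
  (g ∘ f) ⊠ idm w = (g ⊠ idm w) ∘ (f ⊠ idm w).
Proof. by rewrite -tensM comp1m. Qed.

Lemma tensMr (x y z w : C) (g : hom y z) (f : hom x y) :
  idm w ⊠ (g ∘ f) = (idm w ⊠ g) ∘ (idm w ⊠ f).
Proof. by rewrite -tensM comp1m. Qed.

Lemma invertible_comp (x y z : C) (g : hom y z) (f : hom x y) :
  invertible g -> invertible f -> invertible (g ∘ f).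
Proof.
move=> [g' [g'g gg']] [f' [f'f ff']]; exists (f' ∘ g'); split.
- by rewrite -compmA (compmA g') g'g comp1m.
- by rewrite -compmA (compmA f) ff' comp1m.
Qed.

Lemma invertible_tens1 (x y z : C) (f : hom x y) :
  invertible f -> invertible (f ⊠ idm z).
Proof.
move=> [f' [f'f ff']]; exists (f' ⊠ idm z).
by rewrite -!tensM !comp1m f'f ff' !tens1.
Qed.

End TensorLemmas.

Record oplax_functor (k : fieldType) (C D : monoidal k) := OplaxFunctor {
  oplax_fun :> functor C D;
  opl2 : forall x y : C, hom (oplax_fun (x ⊗ y)) (oplax_fun x ⊗ oplax_fun y);
  opl0 : hom (oplax_fun (munit C)) (munit D);
  opl2_nat : forall (x x' y y' : C) (f : hom x x') (g : hom y y'),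
    opl2 x' y' ∘ fmap oplax_fun (f ⊠ g) = (fmap oplax_fun f ⊠ fmap oplax_fun g) ∘ opl2 x y;
  opl2_assoc : forall x y z : C,
    massoc (oplax_fun x) (oplax_fun y) (oplax_fun z)
      ∘ (opl2 x y ⊠ idm (oplax_fun z)) ∘ opl2 (x ⊗ y) z
    = (idm (oplax_fun x) ⊠ opl2 y z) ∘ opl2 x (y ⊗ z) ∘ fmap oplax_fun (massoc x y z);
  opl2_lunit : forall x : C,
    mlunit (oplax_fun x) ∘ (opl0 ⊠ idm (oplax_fun x)) ∘ opl2 (munit C) x
    = fmap oplax_fun (mlunit x);
  opl2_runit : forall x : C,
    mrunit (oplax_fun x) ∘ (idm (oplax_fun x) ⊠ opl0) ∘ opl2 x (munit C)
    = fmap oplax_fun (mrunit x)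
}.

Arguments opl0 {k C D} o.

Section OplaxLemmas.
Variables (k : fieldType) (C D : monoidal k) (F : oplax_functor C D).

Lemma opl2_natl (x y z : C) (f : hom x y) :
  opl2 F y z ∘ fmap F (f ⊠ idm z) = (fmap F f ⊠ idm (F z)) ∘ opl2 F x z.
Proof. by rewrite opl2_nat fmap1. Qed.

Lemma opl2_natr (x y z : C) (f : hom x y) :
  opl2 F z y ∘ fmap F (idm z ⊠ f) = (idm (F z) ⊠ fmap F f) ∘ opl2 F z x.
Proof. by rewrite opl2_nat fmap1. Qed.

End OplaxLemmas.

Definition strong_monoidal (k : fieldType) (C D : monoidal k) (F : oplax_functor C D) : Prop :=
  (forall x y, invertible (opl2 F x y)) /\ invertible (opl0 F).

Record oplax_transformation (k : fieldType) (C D : monoidal k) (F G : oplax_functor C D)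
    (theta : forall x, hom (F x) (G x)) : Prop := OplaxTransformation {
  opt_nat : natural theta;
  opt2 : forall x y, opl2 G x y ∘ theta (x ⊗ y) = (theta x ⊠ theta y) ∘ opl2 F x y;
  opt0 : opl0 G ∘ theta (munit C) = opl0 F
}.

Program Definition oplax_id (k : fieldType) (C : monoidal k) : oplax_functor C C :=
  @OplaxFunctor k C C (functor_id C) (fun x y => idm (x ⊗ y)) (idm (munit C)) _ _ _ _.
Next Obligation. by move=> *; rewrite comp1m compm1. Qed.
Next Obligation. by move=> *; rewrite !tens1 !compm1 !comp1m. Qed.
Next Obligation. by move=> *; rewrite tens1 !compm1. Qed.
Next Obligation. by move=> *; rewrite tens1 !compm1. Qed.

Section OplaxComp.
Variables (k : fieldType) (C D E : monoidal k).
Variables (G : oplax_functor D E) (F : oplax_functor C D).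

Let GF := functor_comp G F.
Let gf2 (x y : C) : hom (GF (x ⊗ y)) (GF x ⊗ GF y) :=
  opl2 G (F x) (F y) ∘ fmap G (opl2 F x y).
Let gf0 : hom (GF (munit C)) (munit E) := opl0 G ∘ fmap G (opl0 F).

Lemma gf2_nat (x x' y y' : C) (f : hom x x') (g : hom y y') :
  gf2 x' y' ∘ fmap GF (f ⊠ g) = (fmap GF f ⊠ fmap GF g) ∘ gf2 x y.
Proof.
rewrite /gf2 /GF /= -compmA -fmapM opl2_nat fmapM.
by rewrite compmA opl2_nat -compmA.
Qed.

Lemma gf2_assoc (x y z : C) :
  massoc (GF x) (GF y) (GF z) ∘ (gf2 x y ⊠ idm (GF z)) ∘ gf2 (x ⊗ y) z
  = (idm (GF x) ⊠ gf2 y z) ∘ gf2 x (y ⊗ z) ∘ fmap GF (massoc x y z).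
Proof.
rewrite /gf2 /GF /= tensMl tensMr -!compmA.
rewrite (compmA (fmap G (opl2 F x y) ⊠ _)) -opl2_natl.
rewrite (compmA (_ ⊠ fmap G (opl2 F y z))) -opl2_natr.
rewrite !compmA opl2_assoc -!compmA -!fmapM !compmA.
by rewrite -opl2_assoc.
Qed.

Lemma gf2_lunit (x : C) :
  mlunit (GF x) ∘ (gf0 ⊠ idm (GF x)) ∘ gf2 (munit C) x = fmap GF (mlunit x).
Proof.
rewrite /gf0 /gf2 /GF /= tensMl -!compmA (compmA (fmap G _ ⊠ _)) -opl2_natl.
by rewrite !compmA opl2_lunit -!fmapM opl2_lunit.
Qed.

Lemma gf2_runit (x : C) :
  mrunit (GF x) ∘ (idm (GF x) ⊠ gf0) ∘ gf2 x (munit C) = fmap GF (mrunit x).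
Proof.
rewrite /gf0 /gf2 /GF /= tensMr -!compmA (compmA (_ ⊠ fmap G _)) -opl2_natr.
by rewrite !compmA opl2_runit -!fmapM opl2_runit.
Qed.

Definition oplax_comp : oplax_functor C E :=
  OplaxFunctor gf2_nat gf2_assoc gf2_lunit gf2_runit.

End OplaxComp.

Record monad (k : fieldType) (C : category k) := Monad {
  monad_fun :> functor C C;
  monad_mu : forall x, hom (monad_fun (monad_fun x)) (monad_fun x);
  monad_eta : forall x, hom x (monad_fun x);
  monad_mu_nat : @natural k C C (functor_comp monad_fun monad_fun) monad_fun monad_mu;
  monad_eta_nat : @natural k C C (functor_id C) monad_fun monad_eta;
  monad_muA : forall x,
    monad_mu x ∘ fmap monad_fun (monad_mu x) = monad_mu x ∘ monad_mu (monad_fun x);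
  monad_mu_eta_l : forall x, monad_mu x ∘ monad_eta (monad_fun x) = idm (monad_fun x);
  monad_mu_eta_r : forall x,
    monad_mu x ∘ fmap monad_fun (monad_eta x) = idm (monad_fun x)
}.

Record bimonad (k : fieldType) (C : monoidal k) := Bimonad {
  bimonad_fun :> oplax_functor C C;
  mu : forall x, hom (bimonad_fun (bimonad_fun x)) (bimonad_fun x);
  eta : forall x, hom x (bimonad_fun x);
  mu_oplax :
    @oplax_transformation k C C (oplax_comp bimonad_fun bimonad_fun) bimonad_fun mu;
  eta_oplax : @oplax_transformation k C C (oplax_id C) bimonad_fun eta;
  muA : forall x, mu x ∘ fmap bimonad_fun (mu x) = mu x ∘ mu (bimonad_fun x);
  mu_eta_l : forall x, mu x ∘ eta (bimonad_fun x) = idm (bimonad_fun x);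
  mu_eta_r : forall x, mu x ∘ fmap bimonad_fun (eta x) = idm (bimonad_fun x)
}.

Definition bimonad_monad (k : fieldType) (C : monoidal k) (T : bimonad C) : monad C :=
  @Monad k C T (@mu k C T) (@eta k C T)
    (opt_nat (mu_oplax T)) (opt_nat (eta_oplax T))
    (@muA k C T) (@mu_eta_l k C T) (@mu_eta_r k C T).
Coercion bimonad_monad : bimonad >-> monad.

Definition right_fusion (k : fieldType) (C : monoidal k) (T : bimonad C) (x y : C) :
    hom (T (T x ⊗ y)) (T x ⊗ T y) :=
  (mu T x ⊠ idm (T y)) ∘ opl2 T (T x) y.

Definition right_Hopf (k : fieldType) (C : monoidal k) (T : bimonad C) : Prop :=
  forall x y : C, invertible (right_fusion T x y).

Record left_module (k : fieldType) (D : monoidal k) (C : category k) := LeftModule {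
  act : D -> C -> C;
  actm : forall (d d' : D) (c c' : C), hom d d' -> hom c c' -> hom (act d c) (act d' c');
  act1 : forall (d : D) (c : C), actm (idm d) (idm c) = idm (act d c);
  actM : forall (d d' d'' : D) (c c' c'' : C)
      (f' : hom d' d'') (f : hom d d') (g' : hom c' c'') (g : hom c c'),
    actm (f' ∘ f) (g' ∘ g) = actm f' g' ∘ actm f g;
  act_linear_r : forall (d d' : D) (c c' : C) (f : hom d d'),
    linear (@actm d d' c c' f);
  act_linear_l : forall (d d' : D) (c c' : C) (g : hom c c'),
    linear (fun f : hom d d' => actm f g);
  act_assoc : forall d e c, hom (act (d ⊗ e) c) (act d (act e c));
  act_unit : forall c, hom (act (munit D) c) c;
  act_assoc_inv : forall d e c, invertible (act_assoc d e c);
  act_unit_inv : forall c, invertible (act_unit c);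
  act_assoc_nat : forall (d d' e e' : D) (c c' : C)
      (f : hom d d') (g : hom e e') (h : hom c c'),
    act_assoc d' e' c' ∘ actm (f ⊠ g) h = actm f (actm g h) ∘ act_assoc d e c;
  act_unit_nat : forall (c c' : C) (f : hom c c'),
    act_unit c' ∘ actm (idm (munit D)) f = f ∘ act_unit c;
  act_pentagon : forall (d e f : D) (c : C),
    actm (idm d) (act_assoc e f c) ∘ act_assoc d (e ⊗ f) c ∘ actm (massoc d e f) (idm c)
    = act_assoc d e (act f c) ∘ act_assoc (d ⊗ e) f c;
  act_triangle : forall (d : D) (c : C),
    actm (idm d) (act_unit c) ∘ act_assoc d (munit D) c = actm (mrunit d) (idm c)
}.

Record oplax_module_functor (k : fieldType) (D : monoidal k) (C C' : category k)
    (M : left_module D C) (N : left_module D C') (F : functor C C')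
    (Fa : forall d c, hom (F (act M d c)) (act N d (F c))) : Prop := OplaxModuleFunctor {
  omf_nat : forall (d d' : D) (c c' : C) (f : hom d d') (g : hom c c'),
    Fa d' c' ∘ fmap F (actm M f g) = actm N f (fmap F g) ∘ Fa d c;
  omf_assoc : forall (d e : D) (c : C),
    act_assoc N d e (F c) ∘ Fa (d ⊗ e) c
    = actm N (idm d) (Fa e c) ∘ Fa d (act M e c) ∘ fmap F (act_assoc M d e c);
  omf_unit : forall c : C,
    act_unit N (F c) ∘ Fa (munit D) c = fmap F (act_unit M c)
}.

Record module_transformation (k : fieldType) (D : monoidal k) (C C' : category k)
    (M : left_module D C) (N : left_module D C') (F G : functor C C')
    (Fa : forall d c, hom (F (act M d c)) (act N d (F c)))
    (Ga : forall d c, hom (G (act M d c)) (act N d (G c)))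
    (theta : forall c, hom (F c) (G c)) : Prop := ModuleTransformation {
  modt_nat : natural theta;
  modt_act : forall (d : D) (c : C),
    Ga d c ∘ theta (act M d c) = actm N (idm d) (theta c) ∘ Fa d c
}.

Section ModuleMonad.
Variables (k : fieldType) (D : monoidal k) (C : category k) (M : left_module D C).
Variables (T : monad C) (Ta : forall d c, hom (T (act M d c)) (act M d (T c))).

Definition id_act (d : D) (c : C) :
    hom (functor_id C (act M d c)) (act M d (functor_id C c)) :=
  idm (act M d c).

Definition square_act (d : D) (c : C) :
    hom (functor_comp T T (act M d c)) (act M d (functor_comp T T c)) :=
  Ta d (T c) ∘ fmap T (Ta d c).

Record oplax_module_monad : Prop := OplaxModuleMonad {
  omm_functor : oplax_module_functor Ta;
  omm_mu : module_transformation square_act Ta (monad_mu T);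
  omm_eta : module_transformation id_act Ta (monad_eta T)
}.

Definition strong_module_monad : Prop :=
  oplax_module_monad /\ forall d c, invertible (Ta d c).

End ModuleMonad.
Arguments oplax_module_monad {k D C} M T Ta.
Arguments strong_module_monad {k D C} M T Ta.

(* Strong monoidality is used only to make the constraints invertible: the
   structure maps themselves point in the direction of [opl2] and [opl0]. *)
Section StrongModule.
Variables (k : fieldType) (D C : monoidal k) (U : oplax_functor D C).
Hypothesis U_strong : strong_monoidal U.

Let sact (d : D) (c : C) : C := U d ⊗ c.
Let sactm (d d' : D) (c c' : C) (f : hom d d') (g : hom c c') :
  hom (sact d c) (sact d' c') := fmap U f ⊠ g.
Let sassoc (d e : D) (c : C) : hom (sact (d ⊗ e) c) (sact d (sact e c)) :=
  massoc (U d) (U e) c ∘ (opl2 U d e ⊠ idm c).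
Let sunit (c : C) : hom (sact (munit D) c) c :=
  mlunit c ∘ (opl0 U ⊠ idm c).

Lemma sact_pentagon (d e f : D) (c : C) :
  sactm (idm d) (sassoc e f c) ∘ sassoc d (e ⊗ f) c ∘ sactm (massoc d e f) (idm c)
  = sassoc d e (sact f c) ∘ sassoc (d ⊗ e) f c.
Proof.
rewrite /sactm /sassoc /sact fmap1 tensMr -!compmA.
rewrite (compmA (idm _ ⊠ (opl2 U e f ⊠ _))) -massoc_nat -!compmA -!tensMl.
rewrite (compmA (idm (U d) ⊠ opl2 U e f)) -opl2_assoc !tensMl !compmA mpentagon -!compmA.
by congr (_ ∘ _); rewrite compmA massoc_nat -tens1 -!compmA.
Qed.

Lemma sact_triangle (d : D) (c : C) :
  sactm (idm d) (sunit c) ∘ sassoc d (munit D) c = sactm (mrunit d) (idm c).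
Proof.
rewrite /sactm /sassoc /sunit fmap1 tensMr -!compmA.
rewrite (compmA (idm _ ⊠ (opl0 U ⊠ _))) -massoc_nat -!compmA -!tensMl.
by rewrite compmA mtriangle -!tensMl compmA opl2_runit.
Qed.

Program Definition strong_left_module : left_module D C :=
  @LeftModule k D C sact sactm _ _ _ _ sassoc sunit _ _ _ _
    sact_pentagon sact_triangle.
Next Obligation. by move=> *; rewrite /sactm fmap1 tens1. Qed.
Next Obligation. by move=> *; rewrite /sactm fmapM tensM. Qed.
Next Obligation. by move=> *; move=> ? ? ?; rewrite /sactm tens_linear_r. Qed.
Next Obligation. by move=> *; move=> ? ? ?; rewrite /sactm fmap_linear tens_linear_l. Qed.
Next Obligation.
move=> d e c; apply: invertible_comp; first exact: massoc_inv.
by apply: invertible_tens1; case: U_strong.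
Qed.
Next Obligation.
move=> c; apply: invertible_comp; first exact: mlunit_inv.
by apply: invertible_tens1; case: U_strong.
Qed.
Next Obligation.
move=> d d' e e' c c' f g h; rewrite /sassoc /sactm -compmA -tensM comp1m opl2_nat.
by rewrite -{1}[h]compm1 tensM compmA massoc_nat compmA.
Qed.
Next Obligation.
move=> c c' f; rewrite /sunit /sactm -compmA -tensM fmap1 compm1 comp1m.
by rewrite -[opl0 U]comp1m -{1}[f]compm1 tensM compmA mlunit_nat comp1m compmA.
Qed.

End StrongModule.

Record oplax_adjunction (k : fieldType) (C D : monoidal k) := OplaxAdjunction {
  ladj : oplax_functor C D;
  radj : oplax_functor D C;
  adj_unit : forall x, hom x (radj (ladj x));
  adj_counit : forall d, hom (ladj (radj d)) d;
  adj_unit_oplax :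
    @oplax_transformation k C C (oplax_id C) (oplax_comp radj ladj) adj_unit;
  adj_counit_oplax :
    @oplax_transformation k D D (oplax_comp ladj radj) (oplax_id D) adj_counit;
  adj_zigzag_l : forall x,
    adj_counit (ladj x) ∘ fmap ladj (adj_unit x) = idm (ladj x);
  adj_zigzag_r : forall d,
    fmap radj (adj_counit d) ∘ adj_unit (radj d) = idm (radj d)
}.

Section Adjunction.
Variables (k : fieldType) (C D : monoidal k) (A : oplax_adjunction C D).
Let F := ladj A.
Let U := radj A.
Let e := adj_counit A.
Let n := adj_unit A.

Lemma radj_strong : strong_monoidal U.
Proof.
have [nN n2 n0] := adj_unit_oplax A; have [eN e2 e0] := adj_counit_oplax A.
split=> [x y|].
- exists (fmap U ((e x ⊠ e y) ∘ opl2 F (U x) (U y)) ∘ n (U x ⊗ U y)); split.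
    rewrite -compmA -nN /= compmA -fmapM -compmA -e2 /= comp1m.
    exact: adj_zigzag_r.
  rewrite fmapM !compmA opl2_nat -!compmA (compmA (opl2 _ _ _)).
  by rewrite n2 /= compm1 -tensM !adj_zigzag_r tens1.
- exists (fmap U (opl0 F) ∘ n (munit C)); split.
    rewrite /= comp1m in e0; rewrite -compmA -nN /= compmA -fmapM -e0.
    exact: adj_zigzag_r.
  by rewrite compmA; exact: n0.
Qed.

Definition adj_module : left_module D C := strong_left_module radj_strong.

Let T := oplax_comp U F.
Let m (x : C) : hom (T (T x)) (T x) := fmap U (e (F x)).

Lemma adj_mu_oplax : @oplax_transformation k C C (oplax_comp T T) T m.
Proof.
have [eN e2 e0] := adj_counit_oplax A.
split=> [x y f|x y|] /=; rewrite /m /=.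
- by rewrite -!fmapM (eN _ _ (fmap F f)).
- rewrite -compmA -fmapM (eN _ _ (opl2 F x y)) /= fmapM !compmA.
  have {}e2 := e2 (F x) (F y); rewrite /= comp1m in e2.
  by rewrite e2 !fmapM !compmA opl2_nat.
- rewrite -compmA -fmapM (eN _ _ (opl0 F)) /=.
  rewrite /= comp1m in e0; rewrite e0.
  by rewrite !fmapM !compmA.
Qed.

Program Definition adj_bimonad : bimonad C :=
  @Bimonad k C T m n adj_mu_oplax (adj_unit_oplax A) _ _ _.
Next Obligation.
move=> x; rewrite /m /= -!fmapM.
by have [eN _ _] := adj_counit_oplax A; rewrite (eN _ _ (e (F x))).
Qed.
Next Obligation. by move=> x; rewrite /m adj_zigzag_r. Qed.
Next Obligation. by move=> x; rewrite /m -fmapM adj_zigzag_l fmap1. Qed.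

Definition adj_coherence (d : D) (c : C) :
    hom (adj_bimonad (act adj_module d c)) (act adj_module d (adj_bimonad c)) :=
  (fmap (radj A) (adj_counit A d) ⊠ idm (adj_bimonad c))
    ∘ opl2 adj_bimonad (radj A d) c.

End Adjunction.

Record algebra (k : fieldType) (C : category k) (T : monad C) := Algebra {
  alg_obj :> C;
  alg_act : hom (T alg_obj) alg_obj;
  alg_unit : alg_act ∘ monad_eta T alg_obj = idm alg_obj;
  alg_mul : alg_act ∘ fmap T alg_act = alg_act ∘ monad_mu T alg_obj
}.

Section AlgebraHom.
Variables (k : fieldType) (C : category k) (T : monad C) (a b : algebra T).

Definition alg_morph : {pred hom a b} :=
  [pred f : hom a b | f ∘ alg_act a == alg_act b ∘ fmap T f].

Record em_hom := EMHom { em_val :> hom a b; em_valP : em_val \in alg_morph }.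

Lemma em_homE (f : em_hom) : em_val f ∘ alg_act a = alg_act b ∘ fmap T (em_val f).
Proof. by apply/eqP; exact: em_valP. Qed.

Lemma alg_morph_submod : submod_closed alg_morph.
Proof.
have lin0 (V W : lmodType k) (h : V -> W) : linear h -> h 0 = 0.
  by move=> lin_h; move: (lin_h (-1) 0 0); rewrite !scaleN1r oppr0 addr0 => ->; rewrite addNr.
split.
- rewrite inE (lin0 _ _ _ (@fmap_linear _ _ _ T a b)).
  rewrite (lin0 _ _ _ (comp_linear_r _)).
  by rewrite (lin0 _ _ (fun g => g ∘ _) (comp_linear_l _)).
- move=> t f g; rewrite !inE => /eqP hf /eqP hg; apply/eqP.
  by rewrite (comp_linear_l _ t f g) fmap_linear comp_linear_r hf hg.
Qed.

HB.instance Definition _ :=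
  GRing.isSubmodClosed.Build k (hom a b) alg_morph alg_morph_submod.
HB.instance Definition _ := [isSub for em_val].
HB.instance Definition _ := [Choice of em_hom by <:].
HB.instance Definition _ := [SubChoice_isSubLmodule of em_hom by <:].

End AlgebraHom.
Arguments alg_morph {k C T} a b.

Section EMCategory.
Variables (k : fieldType) (C : category k) (T : monad C).

Lemma em_idP (a : algebra T) : idm a \in alg_morph a a.
Proof. by rewrite inE fmap1 comp1m compm1. Qed.

Lemma em_compP (a b c : algebra T) (g : em_hom b c) (f : em_hom a b) :
  em_val g ∘ em_val f \in alg_morph a c.
Proof. by rewrite inE -compmA em_homE compmA em_homE -compmA -fmapM. Qed.

Program Definition em_cat : category k :=
  @Category k (algebra T) (fun a b => em_hom a b) (fun a => EMHom (em_idP a))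
    (fun a b c g f => EMHom (em_compP g f)) _ _ _ _ _.
Next Obligation. by move=> a b f; apply: val_inj; rewrite /= comp1m. Qed.
Next Obligation. by move=> a b f; apply: val_inj; rewrite /= compm1. Qed.
Next Obligation. by move=> a b c d h g f; apply: val_inj; rewrite /= compmA. Qed.
Next Obligation.
by move=> a b c g t f f'; apply: val_inj; rewrite /= comp_linear_r.
Qed.
Next Obligation.
by move=> a b c f t g g'; apply: val_inj; rewrite /= (comp_linear_l _ t).
Qed.

Definition em_forget : functor em_cat C :=
  @Functor k em_cat C (fun a => a) (fun a b (f : em_hom a b) => em_val f)
    (fun=> erefl) (fun _ _ _ _ _ => erefl) (fun _ _ _ _ _ => erefl).

Definition em_free_obj (x : C) : algebra T :=
  @Algebra k C T (T x) (monad_mu T x) (monad_mu_eta_l T x) (monad_muA T x).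

Lemma em_freeP (x y : C) (f : hom x y) :
  fmap T f \in alg_morph (em_free_obj x) (em_free_obj y).
Proof. by rewrite inE (monad_mu_nat T f). Qed.

Program Definition em_free : functor C em_cat :=
  @Functor k C em_cat em_free_obj (fun x y f => EMHom (em_freeP f)) _ _ _.
Next Obligation. by move=> x; apply: val_inj; rewrite /= fmap1. Qed.
Next Obligation. by move=> x y z g f; apply: val_inj; rewrite /= fmapM. Qed.
Next Obligation. by move=> x y t f g; apply: val_inj; rewrite /= fmap_linear. Qed.

Lemma em_counitP (a : algebra T) : alg_act a \in alg_morph (em_free_obj a) a.
Proof. by rewrite inE alg_mul. Qed.

Definition em_counit (a : algebra T) : em_hom (em_free_obj a) a := EMHom (em_counitP a).

Lemma em_invertible (a b : algebra T) (f : em_hom a b) :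
  invertible (em_val f) -> @invertible k em_cat a b f.
Proof.
move=> [g [gf fg]].
have gP : g \in alg_morph b a.
  rewrite inE -[alg_act a]comp1m -gf -(compmA g) em_homE.
  by rewrite -!compmA -fmapM fg fmap1 compm1.
by exists (EMHom gP); split; apply: val_inj.
Qed.

End EMCategory.

Section EMMonoidal.
Variables (k : fieldType) (C : monoidal k) (T : bimonad C).

Definition em_tens_act (a b : algebra T) : hom (T (a ⊗ b)) (a ⊗ b) :=
  (alg_act a ⊠ alg_act b) ∘ opl2 T a b.

Lemma em_tens_unit (a b : algebra T) :
  em_tens_act a b ∘ monad_eta T (a ⊗ b) = idm (a ⊗ b).
Proof.
have [_ n2 _] := eta_oplax T.
by rewrite /em_tens_act -compmA n2 /= compm1 -tensM !alg_unit tens1.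
Qed.

Lemma em_tens_mul (a b : algebra T) :
  em_tens_act a b ∘ fmap T (em_tens_act a b) = em_tens_act a b ∘ monad_mu T (a ⊗ b).
Proof.
have [_ m2 _] := mu_oplax T.
rewrite /em_tens_act -[RHS]compmA m2 /= fmapM !compmA -(compmA _ (opl2 T a b)) opl2_nat.
by rewrite !compmA -!tensM !alg_mul.
Qed.

Definition em_tens (a b : algebra T) : algebra T :=
  @Algebra k C T (a ⊗ b) (em_tens_act a b) (em_tens_unit a b) (em_tens_mul a b).

Lemma em_one_unit : opl0 T ∘ monad_eta T (munit C) = idm (munit C).
Proof. by have [_ _ n0] := eta_oplax T; rewrite n0. Qed.

Lemma em_one_mul : opl0 T ∘ fmap T (opl0 T) = opl0 T ∘ monad_mu T (munit C).
Proof. by have [_ _ m0] := mu_oplax T; rewrite m0. Qed.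

Definition em_one : algebra T :=
  @Algebra k C T (munit C) (opl0 T) em_one_unit em_one_mul.

Lemma em_tensmP (a a' b b' : algebra T) (f : em_hom a a') (g : em_hom b b') :
  em_val f ⊠ em_val g \in alg_morph (em_tens a b) (em_tens a' b').
Proof.
by rewrite inE /= /em_tens_act -compmA opl2_nat !compmA -!tensM !em_homE.
Qed.

Lemma em_assocP (a b c : algebra T) :
  massoc a b c \in alg_morph (em_tens (em_tens a b) c) (em_tens a (em_tens b c)).
Proof.
rewrite inE /= /em_tens_act /= /em_tens_act.
have -> : ((alg_act a ⊠ alg_act b) ∘ opl2 T a b) ⊠ alg_act c
    = ((alg_act a ⊠ alg_act b) ⊠ alg_act c) ∘ (opl2 T a b ⊠ idm (T c)).
  by rewrite -tensM compm1.
have -> : alg_act a ⊠ ((alg_act b ⊠ alg_act c) ∘ opl2 T b c)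
    = (alg_act a ⊠ (alg_act b ⊠ alg_act c)) ∘ (idm (T a) ⊠ opl2 T b c).
  by rewrite -tensM compm1.
rewrite !compmA massoc_nat -(compmA (_ ⊠ _) (massoc _ _ _)) -(compmA (_ ⊠ _) (_ ∘ _)).
by rewrite opl2_assoc !compmA.
Qed.

Lemma em_lunitP (a : algebra T) : mlunit a \in alg_morph (em_tens em_one a) a.
Proof.
rewrite inE /= /em_tens_act /= -opl2_lunit.
have -> : opl0 T ⊠ alg_act a = (idm (munit C) ⊠ alg_act a) ∘ (opl0 T ⊠ idm (T a)).
  by rewrite -tensM comp1m compm1.
by rewrite !compmA mlunit_nat.
Qed.

Lemma em_runitP (a : algebra T) : mrunit a \in alg_morph (em_tens a em_one) a.
Proof.
rewrite inE /= /em_tens_act /= -opl2_runit.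
have -> : alg_act a ⊠ opl0 T = (alg_act a ⊠ idm (munit C)) ∘ (idm (T a) ⊠ opl0 T).
  by rewrite -tensM comp1m compm1.
by rewrite !compmA mrunit_nat.
Qed.

Program Definition em_monoidal : monoidal k :=
  @Monoidal k (em_cat T) em_tens (fun a a' b b' f g => EMHom (em_tensmP f g)) _ _ _ _
    em_one (fun a b c => EMHom (em_assocP a b c)) (fun a => EMHom (em_lunitP a))
    (fun a => EMHom (em_runitP a)) _ _ _ _ _ _ _ _.
Next Obligation. by move=> *; apply: val_inj; rewrite /= tens1. Qed.
Next Obligation. by move=> *; apply: val_inj; rewrite /= tensM. Qed.
Next Obligation. by move=> *; move=> ? ? ?; apply: val_inj; rewrite /= tens_linear_r. Qed.
Next Obligation. by move=> *; move=> ? ? ?; apply: val_inj; rewrite /= tens_linear_l. Qed.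
Next Obligation. by move=> *; apply: em_invertible; exact: massoc_inv. Qed.
Next Obligation. by move=> *; apply: em_invertible; exact: mlunit_inv. Qed.
Next Obligation. by move=> *; apply: em_invertible; exact: mrunit_inv. Qed.
Next Obligation. by move=> *; apply: val_inj; rewrite /= massoc_nat. Qed.
Next Obligation. by move=> *; apply: val_inj; rewrite /= mlunit_nat. Qed.
Next Obligation. by move=> *; apply: val_inj; rewrite /= mrunit_nat. Qed.
Next Obligation. by move=> *; apply: val_inj; rewrite /= mpentagon. Qed.
Next Obligation. by move=> *; apply: val_inj; rewrite /= mtriangle. Qed.

Program Definition em_forget_oplax : oplax_functor em_monoidal C :=
  @OplaxFunctor k em_monoidal C (em_forget T) (fun a b => idm (alg_obj a ⊗ alg_obj b))
    (idm (munit C)) _ _ _ _.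
Next Obligation. by move=> *; rewrite comp1m compm1. Qed.
Next Obligation. by move=> *; rewrite !tens1 !compm1 !comp1m. Qed.
Next Obligation. by move=> *; rewrite tens1 !compm1. Qed.
Next Obligation. by move=> *; rewrite tens1 !compm1. Qed.

Lemma em_free2P (x y : C) :
  opl2 T x y \in alg_morph (em_free_obj T (x ⊗ y)) (em_tens (em_free_obj T x) (em_free_obj T y)).
Proof.
have [_ m2 _] := mu_oplax T.
by rewrite inE /= /em_tens_act m2 /= -!compmA.
Qed.

Lemma em_free0P : opl0 T \in alg_morph (em_free_obj T (munit C)) em_one.
Proof. by rewrite inE /= em_one_mul. Qed.

Program Definition em_free_oplax : oplax_functor C em_monoidal :=
  @OplaxFunctor k C em_monoidal (em_free T) (fun x y => EMHom (em_free2P x y))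
    (EMHom em_free0P) _ _ _ _.
Next Obligation. by move=> *; apply: val_inj; rewrite /= opl2_nat. Qed.
Next Obligation. by move=> *; apply: val_inj; rewrite /= opl2_assoc. Qed.
Next Obligation. by move=> *; apply: val_inj; rewrite /= opl2_lunit. Qed.
Next Obligation. by move=> *; apply: val_inj; rewrite /= opl2_runit. Qed.

Lemma em_unit_oplax : @oplax_transformation k C C (oplax_id C)
  (oplax_comp em_forget_oplax em_free_oplax) (@eta k C T).
Proof.
have [nN n2 n0] := eta_oplax T; split=> [x y f|x y|] /=.
- exact: nN.
- by rewrite comp1m n2.
- by rewrite comp1m n0.
Qed.

Lemma em_counit_oplax : @oplax_transformation k em_monoidal em_monoidal
  (oplax_comp em_free_oplax em_forget_oplax) (oplax_id em_monoidal) (@em_counit k C T).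
Proof.
split=> [a b f|a b|]; apply: val_inj => /=.
- exact: em_homE.
- by rewrite comp1m fmap1 compm1.
- by rewrite comp1m fmap1 compm1.
Qed.

Program Definition em_adjunction : oplax_adjunction C em_monoidal :=
  @OplaxAdjunction k C em_monoidal em_free_oplax em_forget_oplax (@eta k C T)
    (@em_counit k C T) em_unit_oplax em_counit_oplax _ _.
Next Obligation. by move=> x; apply: val_inj; rewrite /= mu_eta_r. Qed.
Next Obligation. by move=> a; rewrite /= alg_unit. Qed.

(* The bimonad induced by the Eilenberg–Moore adjunction is [T] again: the underlying
   monads agree definitionally, the oplax structures up to composition with identities. *)
Lemma em_adjunction_bimonad :
  [/\ forall x y (f : hom x y), fmap (adj_bimonad em_adjunction) f = fmap T f,
      forall x, mu (adj_bimonad em_adjunction) x = mu T x,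
      forall x, eta (adj_bimonad em_adjunction) x = eta T x,
      forall x y, opl2 (adj_bimonad em_adjunction) x y = opl2 T x y
    & opl0 (adj_bimonad em_adjunction) = opl0 T].
Proof. by split=> // *; rewrite /= comp1m. Qed.

End EMMonoidal.

(* Main.v *)
Require Import Defs.
From mathcomp Require Import all_boot ssralg.

Set Implicit Arguments.
Unset Strict Implicit.
Unset Printing Implicit Defensive.

Local Open Scope cat_scope.

(** The objects [U d] carry canonical actions [U ε_d : T (U d) -> U d] of the
    bimonad [T = U F], and the coherence morphism is [T_2] followed by such an
    action on the left factor. This map makes [T] an oplax module monad because these
    actions are natural in [d], associative and unital for [T], and compatible
    with the tensor product and the unit of [D]; the module monad axioms then
    follow from those of the bimonad ([coherence_module_monad]). Associativity
    is naturality of [ε] at [ε] and unitality is a triangle identity. The two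
    compatibilities, [counit_action_tens] and [counit_action_one], use that [ε]
    is an oplax monoidal transformation. On [U (F x) = T x] the canonical action
    is [μ_x], so there the coherence morphism is the fusion operator.

    For the Hopf criterion, invertible coherence morphisms are invertible at
    free algebras, where they are the fusion operators. Conversely, every algebra [a] with
    action [α] is the coequaliser of the algebra morphisms [μ_a] and [T α]
    between the free algebras on [T a] and [a], and this fork is split in the
    underlying category by units of [T]. The source [T (a ⊗ c)] and the target
    [a ⊗ T c] of the coherence morphism are functors of the underlying object of
    [a], so they preserve the split fork; by naturality in [a], the coherence
    morphism at [a] is the map induced on split coequalisers by the coherence
    morphisms at two free algebras, and a map induced by isomorphisms is an
    isomorphism ([split_fork_invertible]). *)

(** * Coherence morphisms from compatible actions *)

(** The hypotheses say that [alpha] lifts [U] to an oplax monoidal functor from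
    [D] to the algebras of [T], with structure maps those of [U]. An oplax
    monoidal adjunction provides one, its comparison functor, when [T] is the
    induced bimonad. *)
Section ActionCoherence.
Variables (k : fieldType) (C D : monoidal k) (T : bimonad C).
Variables (U : oplax_functor D C) (alpha : forall d, hom (T (U d)) (U d)).

Hypothesis alpha_nat : forall (d d' : D) (f : hom d d'),
  alpha d' ∘ fmap (bimonad_fun T) (fmap U f) = fmap U f ∘ alpha d.
Hypothesis alpha_mul : forall d : D,
  alpha d ∘ mu T (U d) = alpha d ∘ fmap (bimonad_fun T) (alpha d).
Hypothesis alpha_unit : forall d : D, alpha d ∘ eta T (U d) = idm (U d).
Hypothesis alpha_tens : forall d d' : D,
  opl2 U d d' ∘ alpha (d ⊗ d')
  = (alpha d ⊠ alpha d') ∘ opl2 T (U d) (U d') ∘ fmap (bimonad_fun T) (opl2 U d d').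
Hypothesis alpha_one :
  opl0 U ∘ alpha (munit D) = opl0 T ∘ fmap (bimonad_fun T) (opl0 U).

Let coh (d : D) (c : C) : hom (T (U d ⊗ c)) (U d ⊗ T c) :=
  (alpha d ⊠ idm (T c)) ∘ opl2 T (U d) c.

Lemma coherence_nat (d d' : D) (c c' : C) (f : hom d d') (g : hom c c') :
  coh d' c' ∘ fmap (bimonad_fun T) (fmap U f ⊠ g)
  = (fmap U f ⊠ fmap (bimonad_fun T) g) ∘ coh d c.
Proof.
rewrite /coh -compmA opl2_nat !compmA -!tensM comp1m compm1.
by rewrite alpha_nat.
Qed.

Lemma coherence_assoc (d d' : D) (c : C) :
  massoc (U d) (U d') (T c) ∘ (opl2 U d d' ⊠ idm (T c)) ∘ coh (d ⊗ d') c
  = (idm (U d) ⊠ coh d' c) ∘ coh d (U d' ⊗ c)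
      ∘ fmap (bimonad_fun T) (massoc (U d) (U d') c ∘ (opl2 U d d' ⊠ idm c)).
Proof.
(* The middle term performs all actions after the twofold [T_2]; the two
   bracketings of the latter are exchanged by coassociativity. *)
transitivity ((alpha d ⊠ (alpha d' ⊠ idm (T c)))
    ∘ (massoc _ _ _ ∘ (opl2 T (U d) (U d') ⊠ idm (T c)) ∘ opl2 T (U d ⊗ U d') c)
    ∘ fmap (bimonad_fun T) (opl2 U d d' ⊠ idm c)).
- rewrite /coh -!compmA opl2_natl.
  rewrite (compmA (opl2 U _ _ ⊠ _)) -tensMl alpha_tens !tensMl !compmA.
  by rewrite massoc_nat.
- rewrite opl2_assoc fmapM /coh !compmA -!tensM.
  by rewrite comp1m !compm1.
Qed.

Lemma coherence_unit (c : C) :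
  mlunit (T c) ∘ (opl0 U ⊠ idm (T c)) ∘ coh (munit D) c
  = fmap (bimonad_fun T) (mlunit c ∘ (opl0 U ⊠ idm c)).
Proof.
rewrite fmapM -opl2_lunit /coh -!compmA opl2_natl.
by rewrite (compmA (opl0 U ⊠ _)) -tensMl alpha_one tensMl !compmA.
Qed.

Lemma coherence_mu (d : D) (c : C) :
  coh d c ∘ mu T (U d ⊗ c)
  = (idm (U d) ⊠ mu T c) ∘ (coh d (T c) ∘ fmap (bimonad_fun T) (coh d c)).
Proof.
have [_ m2 _] := mu_oplax T.
transitivity (((alpha d ∘ mu T (U d)) ⊠ mu T c)
    ∘ (opl2 T (T (U d)) (T c) ∘ fmap (bimonad_fun T) (opl2 T (U d) c))).
- by rewrite /coh -compmA m2 /= !compmA -tensM comp1m.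
- rewrite alpha_mul /coh fmapM.
  rewrite -!compmA (compmA (opl2 T _ _) (fmap _ (_ ⊠ _))) opl2_natl.
  by rewrite !compmA -!tensM !comp1m !compm1.
Qed.

Lemma coherence_eta (d : D) (c : C) :
  coh d c ∘ eta T (U d ⊗ c) = idm (U d) ⊠ eta T c.
Proof.
have [_ n2 _] := eta_oplax T.
by rewrite /coh -compmA n2 /= compm1 -tensM comp1m alpha_unit.
Qed.

Lemma coherence_module_monad (Us : strong_monoidal U) :
  oplax_module_monad (strong_left_module Us) T coh.
Proof.
split.
- split=> [d d' c c' f g|d d' c|c] /=.
  + exact: coherence_nat.
  + by rewrite fmap1; exact: coherence_assoc.
  + exact: coherence_unit.
- split=> [|d c]; first exact: monad_mu_nat.
  by rewrite /= fmap1; exact: coherence_mu.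
- split=> [|d c]; first exact: monad_eta_nat.
  by rewrite /= fmap1 /id_act compm1; exact: coherence_eta.
Qed.

End ActionCoherence.

(** * The coherence morphisms of an oplax monoidal adjunction *)

Section AdjunctionCoherence.
Variables (k : fieldType) (C D : monoidal k) (A : oplax_adjunction C D).
Let U := radj A.
Let T := adj_bimonad A.

Let counit_action (d : D) : hom (T (U d)) (U d) := fmap U (adj_counit A d).

Lemma counit_action_nat (d d' : D) (f : hom d d') :
  counit_action d' ∘ fmap (bimonad_fun T) (fmap U f) = fmap U f ∘ counit_action d.
Proof.
have [eN _ _] := adj_counit_oplax A.
by rewrite /counit_action /= -!fmapM (eN _ _ f).
Qed.

Lemma counit_action_mul (d : D) :
  counit_action d ∘ mu T (U d)
  = counit_action d ∘ fmap (bimonad_fun T) (counit_action d).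
Proof. by rewrite counit_action_nat. Qed.

(** Up to the isomorphism [U_2], the action on [U (d ⊗ d')] is the diagonal
    action on [U d ⊗ U d'], because [ε] is compatible with the structure maps
    of [F U]. *)
Lemma counit_action_tens (d d' : D) :
  opl2 U d d' ∘ counit_action (d ⊗ d')
  = (counit_action d ⊠ counit_action d') ∘ opl2 T (U d) (U d')
      ∘ fmap (bimonad_fun T) (opl2 U d d').
Proof.
have [_ e2 _] := adj_counit_oplax A.
have {}e2 := e2 d d'; rewrite /= comp1m in e2.
by rewrite /counit_action /= e2 !fmapM !compmA opl2_nat.
Qed.

Lemma counit_action_one :
  opl0 U ∘ counit_action (munit D) = opl0 T ∘ fmap (bimonad_fun T) (opl0 U).
Proof.
have [_ _ e0] := adj_counit_oplax A; rewrite /= comp1m in e0.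
by rewrite /counit_action /= e0 fmapM compmA.
Qed.

Lemma adj_coherence_nat (d d' : D) (c c' : C) (f : hom d d') (g : hom c c') :
  adj_coherence A d' c' ∘ fmap (bimonad_fun T) (fmap U f ⊠ g)
  = (fmap U f ⊠ fmap (bimonad_fun T) g) ∘ adj_coherence A d c.
Proof. exact: coherence_nat counit_action_nat _ _ _ _ _ _. Qed.

Lemma adj_coherence_module_monad :
  oplax_module_monad (adj_module A) T (adj_coherence A).
Proof.
exact: coherence_module_monad counit_action_nat counit_action_mul
  (adj_zigzag_r A) counit_action_tens counit_action_one (radj_strong A).
Qed.

End AdjunctionCoherence.

(** * Split forks *)

(** Transported along [f0] and [f1], the map [p] coequalises [u'] and [v'], so
    it factors through the split coequaliser [q]: the factorisation is
    [p ∘ f0^-1 ∘ s], and it inverts [f]. The section [r] serves to cancel [p]. *)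
Lemma split_fork_invertible (k : fieldType) (C : category k)
    (x1 x0 x y1 y0 y : C) (u v : hom x1 x0) (p : hom x0 x) (r : hom x x0)
    (u' v' : hom y1 y0) (q : hom y0 y) (s : hom y y0) (t : hom y0 y1)
    (f1 : hom x1 y1) (f0 : hom x0 y0) (f : hom x y) :
  p ∘ u = p ∘ v -> p ∘ r = idm x ->
  q ∘ s = idm y -> s ∘ q = v' ∘ t -> u' ∘ t = idm y0 ->
  f0 ∘ u = u' ∘ f1 -> f0 ∘ v = v' ∘ f1 -> f ∘ p = q ∘ f0 ->
  invertible f1 -> invertible f0 -> invertible f.
Proof.
move=> pu pr qs sq ut fu fv fp [g1 [_ f1g1]] [g0 [g0f0 f0g0]].
have g0v : g0 ∘ v' = v ∘ g1.
  by rewrite -[v']compm1 -f1g1 (compmA v') -fv !compmA g0f0 comp1m.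
have g0u : g0 ∘ u' = u ∘ g1.
  by rewrite -[u']compm1 -f1g1 (compmA u') -fu !compmA g0f0 comp1m.
exists (p ∘ g0 ∘ s); split; last first.
  by rewrite !compmA fp -(compmA q) f0g0 compm1.
(* After composition with [p]: [s ∘ q] becomes [v' ∘ t], then [v'] may be
   replaced by [u'] since [p ∘ g0] coequalises them, and [u' ∘ t] cancels. *)
have gfp : p ∘ g0 ∘ s ∘ f ∘ p = p.
  rewrite -compmA fp !compmA -(compmA _ s q) sq !compmA -(compmA p) g0v.
  by rewrite compmA -pu -(compmA p) -g0u !compmA -(compmA _ u') ut compm1 -compmA g0f0 compm1.
by rewrite -[LHS]compm1 -pr compmA gfp.
Qed.

(** * Fusion operators and the coherence over all algebras *)

Section EilenbergMoore.
Variables (k : fieldType) (C : monoidal k) (T : bimonad C).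
Let coh := adj_coherence (em_adjunction T).

(** The action of the free algebra on [x] is [μ_x]. *)
Lemma em_coherence_free (x c : C) :
  coh (em_free_obj T x) c = right_fusion T x c.
Proof. by rewrite /coh /adj_coherence /right_fusion /= comp1m. Qed.

(** The axioms of a module monad depend on the underlying monad only, and the
    bimonad induced by the adjunction has the same underlying monad as [T]. *)
Lemma em_coherence_module_monad :
  oplax_module_monad (adj_module (em_adjunction T)) T coh.
Proof.
have [[N As Un] [mN mA] [nN nA]] := adj_coherence_module_monad (em_adjunction T).
by split; split.
Qed.

Lemma em_coherence_natl (a b : algebra T) (f : em_hom a b) (c : C) :
  coh b c ∘ fmap T (em_val f ⊠ idm c) = (em_val f ⊠ idm (T c)) ∘ coh a c.
Proof.
by have := @adj_coherence_nat k C _ (em_adjunction T) a b c c f (idm c); rewrite /= fmap1.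
Qed.

(** The fork is [μ_a], [T α] : [T (T a) -> T a] followed by the action [α] of
    [a]; it is split by [η_a] and [η_(T a)]. Its upper row is the image under
    [T (_ ⊗ c)], its lower row the image under [_ ⊗ T c]. *)
Lemma em_coherence_invertible (a : algebra T) (c : C) :
  right_Hopf T -> invertible (coh a c).
Proof.
move=> hopf.
have free_inv (x : C) : invertible (coh (em_free_obj T x) c).
  by rewrite em_coherence_free; exact: hopf.
apply: (@split_fork_invertible _ _ _ _ _ _ _ _
  (fmap T (mu T a ⊠ idm c)) (fmap T (fmap T (alg_act a) ⊠ idm c))
  (fmap T (alg_act a ⊠ idm c)) (fmap T (eta T a ⊠ idm c))
  (mu T a ⊠ idm (T c)) (fmap T (alg_act a) ⊠ idm (T c))
  (alg_act a ⊠ idm (T c)) (eta T a ⊠ idm (T c)) (eta T (T a) ⊠ idm (T c))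
  (coh (em_free_obj T (T a)) c) (coh (em_free_obj T a) c)).
- by rewrite -!fmapM -!tensMl -alg_mul.
- by rewrite -fmapM -tensMl (alg_unit a) tens1 fmap1.
- by rewrite -tensMl (alg_unit a) tens1.
- by rewrite -!tensMl (monad_eta_nat T (alg_act a)).
- by rewrite -tensMl mu_eta_l tens1.
- exact: (@em_coherence_natl _ _ (em_counit (em_free_obj T a)) c).
- exact: (@em_coherence_natl _ _ (fmap (em_free T) (alg_act a)) c).
- exact: (@em_coherence_natl _ _ (em_counit a) c).
- exact: free_inv.
- exact: free_inv.
Qed.

Lemma right_Hopf_em_coherence :
  right_Hopf T <-> forall (a : em_monoidal T) (c : C), invertible (coh a c).
Proof.
split=> [hopf a c|inv x y]; first exact: em_coherence_invertible.
by rewrite -em_coherence_free; exact: (inv (em_free_obj T x)).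
Qed.

End EilenbergMoore.

Theorem lemma9p47 (k : fieldType) :
  (forall (C D : monoidal k) (A : oplax_adjunction C D),
     oplax_module_monad (adj_module A) (adj_bimonad A) (adj_coherence A)
     /\ forall x c : C,
          adj_coherence A (ladj A x) c = right_fusion (adj_bimonad A) x c)
  /\
  (forall (C : monoidal k) (T : bimonad C),
     oplax_module_monad (adj_module (em_adjunction T)) T
       (adj_coherence (em_adjunction T))
     /\ ((forall x y : C, invertible (right_fusion T x y)) <->
         (forall (a : em_monoidal T) (c : C),
            invertible (adj_coherence (em_adjunction T) a c)))
     /\ (right_Hopf T <->
         strong_module_monad (adj_module (em_adjunction T)) T
           (adj_coherence (em_adjunction T)))).
Proof.
split=> [C D A|C T].
  by split=> [|x c //]; exact: adj_coherence_module_monad.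
have modT := em_coherence_module_monad T.
have hopfE := right_Hopf_em_coherence T.
split=> //; split=> //.
by rewrite /strong_module_monad; split=> [/hopfE|[_ /hopfE]].
Qed.
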